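(* Let $\{m_\theta:\theta\in\Theta\}$ be a regular one-parameter family with score $s$ and Fisher information $I=\mathsf{E}(s^2)$ (as described in the context), and let $\mathcal{G}$ be its space of generalized estimators for $\theta$. For every $g\in\mathcal{G}$, the information for $\theta$ utilized by $g$ is bounded by the Fisher information: $$\Lambda(g)\le I$$ (at every $\theta\in\Theta$). Furthermore, the score $s$ attains this bound, i.e. $\Lambda(s)=I$, and for any $g\in\mathcal{G}$ $$\Lambda(g)=\mathsf{V}(\mathsf{P}_g s)=\mathsf{R}^2 I$$ as functions on $\Theta$, where $\mathsf{P}_g s$ is the projection of $s$ onto the space spanned by $g$ and $\mathsf{R}=\mathsf{E}(\bar s\,\bar g)$ is the correlation between $s$ and $g$.
   Context: Family. $\mathcal{Y}$ is a sample space with dominating measure $\mu$ (counting measure when $\mathcal{Y}$ is discrete). $M$ is a family of probability densities $m>0$ on $\mathcal{Y}$ with respect to $\mu$ (common support) which is a connected 1-dimensional smooth manifold with a global parameterization (diffeomorphism) $\theta:M\to\Theta$, where $\Theta\subset\mathbb{R}$ is an open interval. Write $m_\theta$ for the member of $M$ with parameter $\theta$, and $E_\theta h=\int_{\mathcal{Y}}h\,m_\theta\,d\mu$. Hilbert spaces. $H_M=\{h:\mathcal{Y}\to\mathbb{R}\text{ measurable}: E_m h^2<\infty\ \forall m\in M\}$. At each $\theta$ it carries the inner product $\langle h,h'\rangle_\theta=E_\theta(hh')$, and $H_\theta^\perp=\{h\in H_M:E_\theta h=0\}$. For $f:\mathcal{Y}\times\Theta\to\mathbb{R}$, $\mathsf{E}f$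 denotes the function $\theta\mapsto E_\theta f(\cdot,\theta)$ on $\Theta$, and $\nabla=\partial/\partial\theta$. Score. $\ell(y,\theta)=\log m_\theta(y)$ and $s=\nabla\ell$. The Fisher information is $I=\mathsf{E}(s^2)$, a function on $\Theta$. Generalized estimators. A generalized estimator is a function $g:\mathcal{Y}\times\Theta\to\mathbb{R}$ such that (i) $g(y,\cdot)\in C^1(\Theta)$ for a.e. $y$; (ii) $g(\cdot,\theta)\in H_\theta^\perp$ for all $\theta$; (iii) $\mathsf{V}(g)>0$ on $\Theta$, where $\mathsf{V}(g)=\mathsf{E}(g^2)\in C^1(\Theta)$. The set of these is $\mathcal{G}$. Standing assumptions. $s(\cdot,\theta)\in H_M$ for all $\theta$, $\mathsf{E}s=0$, and $s\in\mathcal{G}$ (in particular $I>0$). Differentiation commutes with integration: for every $f:\mathcal{Y}\times\Theta\to\mathbb{R}$ that is $C^1$ in $\theta$ for a.e. $y$, with $f(\cdot,\theta)\in H_M$ for all $\theta$ and $\mathsf{E}(f^2)\in C^1(\Theta)$ positive (in particular for every $f\in\mathcal{G}$), the expectation $\mathsf{E}(\nabla f)$ exists and $\nabla(\mathsf{E}f)=\mathsf{E}(\nabla f)+\mathsf{E}((\nabla\ell)f)$. Standardization and information. $\bar g=g/\sqrt{\mathsf{V}(g)}$ and $\bar s=s/\sqrt{\mathsf{V}(s)}$. The information for $\theta$ utilized by $g$ is the function on $\Theta$ $$\Lambda(g)=(\mathsf{E}\nabla\bar g)^2=\frac{(\mathsf{E}\nabla g)^2}{\mathsf{E}(g^2)}.$$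 Projection. At each $\theta$, $\mathsf{P}_g s$ is the orthogonal projection of $s(\cdot,\theta)$ onto the line spanned by $g(\cdot,\theta)$ with respect to $\langle\cdot,\cdot\rangle_\theta$. $\mathsf{V}(\mathsf{P}_g s)=\mathsf{E}((\mathsf{P}_g s)^2)$. *)

(* Defs.v *)
From HB Require Import structures.
From mathcomp Require Import all_boot all_order all_algebra.
From mathcomp Require Import all_classical all_reals all_analysis.
Set Implicit Arguments.
Unset Strict Implicit.
Unset Printing Implicit Defensive.
Import Order.TTheory GRing.Theory Num.Theory.
Import numFieldNormedType.Exports.
Local Open Scope classical_set_scope.
Local Open Scope ring_scope.

(* A function f on Y x Theta is represented by f : Y -> R -> R; only its values
   at parameters in the open interval Theta matter. *)

(* Theta is meant to be open, so the two-sided derivative of the ambient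
   function on R is the derivative of its restriction to Theta. *)
Definition C1_on (R : realType) (Theta : set R) (f : R -> R) : Prop :=
  forall t, Theta t -> derivable f t 1 /\ {for t, continuous (derive1 f)}.

Definition grad (R : realType) (Y : Type) (f : Y -> R -> R) : Y -> R -> R :=
  fun y t => derive1 (f y) t.

Section OneParameterFamily.
Context (R : realType) (d : measure_display) (Y : measurableType d).
Context (mu : {measure set Y -> \bar R}) (Theta : set R) (m : R -> Y -> R).
Implicit Types (h p q : Y -> R) (f g : Y -> R -> R) (t : R).

Definition Expect t h : R := \int[mu]_(y in setT) (h y * m t y).

Definition HM h : Prop :=
  measurable_fun setT h /\
  forall t, Theta t -> (\int[mu]_(y in setT) (h y ^+ 2 * m t y)%:E < +oo)%E.

Definition inner t h q : R := Expect t (fun y => h y * q y).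

Definition Hperp t h : Prop := HM h /\ Expect t h = 0.

Definition EE f : R -> R := fun t => Expect t (f ^~ t).

Definition VV f : R -> R := EE (fun y t => f y t ^+ 2).

(* The partial derivative of f may be undefined, hence take arbitrary and
   possibly non-measurable values, on a mu-null set of y; "its expectation
   exists" is therefore read up to almost everywhere equality.  The value
   EE (grad f) t is not affected by what happens on that null set. *)
Definition expect_exists t h : Prop :=
  exists2 q, mu.-integrable setT (fun y => (q y * m t y)%:E) &
    {ae mu, forall y, h y = q y}.

Definition loglik : Y -> R -> R := fun y t => ln (m t y).

Definition score : Y -> R -> R := grad loglik.

Definition fisher_info : R -> R := EE (fun y t => score y t ^+ 2).

Definition gen_estimator g : Prop :=
  [/\ {ae mu, forall y, C1_on Theta (g y)},
      forall t, Theta t -> Hperp t (g ^~ t),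
      forall t, Theta t -> 0 < VV g t &
      C1_on Theta (VV g)].

Definition standardize g : Y -> R -> R :=
  fun y t => g y t / Num.sqrt (VV g t).

Definition Lambda g : R -> R := fun t => EE (grad (standardize g)) t ^+ 2.

Definition corr f g : R -> R :=
  EE (fun y t => standardize f y t * standardize g y t).

Definition line h : set (Y -> R) :=
  [set p | exists c : R, p = (fun y => c * h y)].

(* The orthogonal projection of h onto the linear subspace L for <.,.>_t,
   selected as the element p of L such that h - p is orthogonal to L
   (with default value 0 should there be none). *)
Definition orth_proj t (L : set (Y -> R)) h : Y -> R :=
  xget (fun=> 0)
    [set p | L p /\ forall q, L q -> inner t (fun y => h y - p y) q = 0].

Definition proj_score g : Y -> R -> R :=
  fun y t => orth_proj t (line (g ^~ t)) (score ^~ t) y.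

(* The manifold structure on M = m @` Theta is the one carried by the global
   parameterization, so M enters through the injective map t |-> m t.
   That score(., t) is in HM with mean 0 is part of score_estimator. *)
Record regular_family : Prop := RegularFamily {
  Theta_interval : is_interval Theta;
  Theta_open : open Theta;
  Theta_nonempty : Theta !=set0;
  param_inj : {in Theta &, injective m};
  density_measurable : forall t, Theta t -> measurable_fun setT (m t);
  density_gt0 : forall t, Theta t -> forall y, 0 < m t y;
  density_mass1 : forall t, Theta t ->
    (\int[mu]_(y in setT) (m t y)%:E = 1)%E;
  loglik_derivable :
    {ae mu, forall y, forall t, Theta t -> derivable (loglik y) t 1};
  score_estimator : gen_estimator score;
  diff_expect : forall f,
    {ae mu, forall y, C1_on Theta (f y)} ->
    (forall t, Theta t -> HM (f ^~ t)) ->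
    (forall t, Theta t -> 0 < VV f t) ->
    C1_on Theta (VV f) ->
    forall t, Theta t ->
      expect_exists t (grad f ^~ t) /\
      is_derive t 1 (EE f)
        (EE (grad f) t + EE (fun y u => score y u * f y u) t)
}.

End OneParameterFamily.

(* Main.v *)
Require Import Defs.
From mathcomp Require Import all_boot all_order all_algebra.
From mathcomp Require Import all_classical all_reals all_analysis.
From mathcomp Require Import measurable_realfun ring lra.
Set Implicit Arguments.
Unset Strict Implicit.
Unset Printing Implicit Defensive.
Import Order.TTheory GRing.Theory Num.Theory.
Import numFieldNormedType.Exports.
Local Open Scope classical_set_scope.
Local Open Scope ring_scope.

(** Because E g = 0 on all of Theta, exchanging derivative and expectation turns
0 = (E g)' into E (grad g) = - E (s g) = - <s, g>: the mean sensitivity of an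
estimator is, up to sign, its inner product with the score ([EE_grad]).  The
standardization of g is again a generalized estimator, with second moment
constantly 1 ([gen_estimator_standardize]), so the same identity applies to it
and gives

  Lambda g = <s, g / sqrt (V g)> ^ 2 = <s, g> ^ 2 / V g      ([LambdaE]).

The theorem then is geometry in the line spanned by g: the projection of s on
that line is (<s, g> / V g) g, whose squared norm is <s, g> ^ 2 / V g; the
correlation is <s, g> / sqrt (I * V g); and the bound is the Cauchy-Schwarz
inequality, an equality for g = s.

Applying the exchange identity to the standardized estimator itself, rather than
differentiating the quotient g / sqrt (V g) under the expectation, matters:
grad g is only almost everywhere equal to a measurable function, and this way
its expectation never has to be split or rescaled. *)

(** * Continuously differentiable functions on an open set *)

Lemma near_open_eq (R : realType) (Theta : set R) (f g : R -> R) (t : R) :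
  open Theta -> (forall u, Theta u -> f u = g u) -> Theta t ->
  \forall u \near t, f u = g u.
Proof.
move=> oT fg Tt; apply: filterS (open_nbhs_nbhs (conj oT Tt)) => u.
exact: fg.
Qed.

(** The continuity clause of [C1_on] is about [derive1 f] on full neighbourhoods;
since Theta is open, a formula for the derivative valid on Theta suffices. *)
Lemma C1_on_is_derive (R : realType) (Theta : set R) (f df : R -> R) :
  open Theta -> (forall t, Theta t -> is_derive t 1 f (df t)) ->
  (forall t, Theta t -> {for t, continuous df}) -> C1_on Theta f.
Proof.
move=> oT dfE dfc t Tt; split; first by have [] := dfE t Tt.
have E u : Theta u -> df u = derive1 f u.
  by move=> Tu; rewrite derive1E; have [_ ->] := dfE u Tu.
suff : derive1 f u @[u --> t] --> df t by rewrite (E t Tt).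
apply: cvg_trans (dfc t Tt); apply: near_eq_cvg.
by apply: (@near_open_eq _ Theta) => //.
Qed.

Lemma is_derive_C1_on (R : realType) (Theta : set R) (f : R -> R) (t : R) :
  C1_on Theta f -> Theta t -> is_derive t 1 f (derive1 f t).
Proof. by move=> fC1 Tt; have [df _] := fC1 t Tt; split; rewrite ?derive1E. Qed.

Lemma continuous_C1_on (R : realType) (Theta : set R) (f : R -> R) (t : R) :
  C1_on Theta f -> Theta t -> {for t, continuous f}.
Proof.
move=> fC1 Tt; have [df _] := fC1 t Tt.
by apply: differentiable_continuous; apply/derivable1_diffP.
Qed.

Lemma C1_on_cst (R : realType) (Theta : set R) (f : R -> R) (c : R) :
  open Theta -> (forall t, Theta t -> f t = c) -> C1_on Theta f.
Proof.
move=> oT fc; apply: (@C1_on_is_derive _ _ _ (fun=> 0)) => // t Tt; last first.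
  exact: cvg_cst.
apply: (@near_eq_is_derive _ _ _ (cst c)).
by apply: (@near_open_eq _ Theta) => // u Tu; rewrite fc.
Qed.

Lemma C1_onM (R : realType) (Theta : set R) (f g : R -> R) :
  open Theta -> C1_on Theta f -> C1_on Theta g ->
  C1_on Theta (fun t => f t * g t).
Proof.
move=> oT fC1 gC1.
apply: (@C1_on_is_derive _ _ _ (fun t => f t * derive1 g t + g t * derive1 f t))
  => // t Tt.
  have := is_deriveM (is_derive_C1_on fC1 Tt) (is_derive_C1_on gC1 Tt).
  exact.
by apply: cvgD; apply: cvgM; [exact: continuous_C1_on fC1 Tt |
  have [] := gC1 t Tt | exact: continuous_C1_on gC1 Tt | have [] := fC1 t Tt].
Qed.

Lemma C1_on_inv_sqrt (R : realType) (Theta : set R) (f : R -> R) :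
  open Theta -> C1_on Theta f -> (forall t, Theta t -> 0 < f t) ->
  C1_on Theta (fun t => (Num.sqrt (f t))^-1).
Proof.
move=> oT fC1 f0.
have s0 t : Theta t -> Num.sqrt (f t) != 0.
  by move=> Tt; rewrite gt_eqF// sqrtr_gt0 f0.
apply: (@C1_on_is_derive _ _ _ (fun t =>
  - (Num.sqrt (f t))^-1 ^+ 2 * ((2 * Num.sqrt (f t))^-1 * derive1 f t))) => // t Tt.
  have d1 := is_derive1_comp (is_derive1_sqrt (f0 t Tt)) (is_derive_C1_on fC1 Tt).
  have := @is_deriveV _ (fun u => Num.sqrt (f u)) t _ 1 (s0 t Tt) d1.
  by rewrite /GRing.scale/= exprVn.
have sc : (Num.sqrt (f u)) @[u --> t] --> Num.sqrt (f t).
  by apply: (@continuous_comp _ _ _ f (@Num.sqrt R));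
    [exact: continuous_C1_on fC1 Tt | exact: sqrt_continuous].
have iv : (Num.sqrt (f u))^-1 @[u --> t] --> (Num.sqrt (f t))^-1.
  by apply: cvgV => //; exact: s0.
apply: cvgM.
  by apply: cvgN; rewrite expr2; under eq_fun do rewrite expr2; apply: cvgM.
apply: cvgM; last by have [] := fC1 t Tt.
apply: cvgV; first by rewrite mulf_neq0// s0.
by apply: cvgM => //; exact: cvg_cst.
Qed.

(** * Second-order moments *)

(** The pointwise domination that makes the product of two square integrable
functions integrable for the density w. *)
Lemma norm_mul_weight_le (R : realDomainType) (a b w : R) : 0 < w ->
  `|a * b * w| <= `|(a ^+ 2 + b ^+ 2) * w|.
Proof.
move=> w0; rewrite normrM [leRHS]normrM (gtr0_norm w0) ler_pM2r//.
rewrite [leRHS]ger0_norm ?addr_ge0 ?sqr_ge0// ler_norml.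
by apply/andP; split; nra.
Qed.

Section Expectation.
Context (R : realType) (d : measure_display) (Y : measurableType d).
Context (mu : {measure set Y -> \bar R}) (Theta : set R) (m : R -> Y -> R).
Context (regM : regular_family mu Theta m).
Implicit Types (h q : Y -> R) (t : R).

Definition expectable t h := mu.-integrable setT (EFin \o (fun y => h y * m t y)).

Lemma expectable_mul h q t : HM mu Theta m h -> HM mu Theta m q -> Theta t ->
  expectable t (fun y => h y * q y).
Proof.
move=> [mh Ih] [mq Iq] Tt.
have mm := density_measurable regM Tt.
have m0 := density_gt0 regM Tt.
have sq (k : Y -> R) : measurable_fun setT k ->
    (forall t, Theta t -> (\int[mu]_(y in setT) (k y ^+ 2 * m t y)%:E < +oo)%E) ->
    expectable t (fun y => k y ^+ 2).
  move=> mk Ik; apply/integrableP; split.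
    apply/measurable_EFinP; apply: measurable_funM => //.
    exact: measurable_funX.
  under eq_integral => y _.
    rewrite /= ger0_norm; last by rewrite mulr_ge0 ?sqr_ge0 ?ltW.
    over.
  exact: Ik.
apply: (le_integrable _ _ _ (integrableD _ (sq h mh Ih) (sq q mq Iq))) => //.
  by apply/measurable_EFinP; do 2 apply: measurable_funM => //.
move=> y _; rewrite lee_fin -mulrDl; apply: norm_mul_weight_le; exact: m0.
Qed.

Lemma ExpectZ t h c : expectable t h ->
  Expect mu m t (fun y => c * h y) = c * Expect mu m t h.
Proof.
move=> ih; rewrite /Expect -RintegralZl//.
by apply: eq_Rintegral => y _; rewrite mulrA.
Qed.

Lemma expectableZ t h c : expectable t h -> expectable t (fun y => c * h y).
Proof.
move=> ih; apply: eq_integrable (integrableZl measurableT c ih) => // y _ /=.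
by rewrite -EFinM mulrA.
Qed.

Lemma ExpectB t h q : expectable t h -> expectable t q ->
  Expect mu m t (fun y => h y - q y) = Expect mu m t h - Expect mu m t q.
Proof.
move=> ih iq; rewrite /Expect -RintegralB//.
by apply: eq_Rintegral => y _; rewrite mulrBl.
Qed.

Lemma Expect_ge0 t h : Theta t -> (forall y, 0 <= h y) -> 0 <= Expect mu m t h.
Proof.
move=> Tt h0; apply: Rintegral_ge0 => y _.
by rewrite mulr_ge0// ltW// (density_gt0 regM).
Qed.

Lemma HMZ h c : HM mu Theta m h -> HM mu Theta m (fun y => c * h y).
Proof.
move=> hH; split; first by apply: measurable_funM => //; have [] := hH.
move=> t Tt.
have /(expectableZ (c ^+ 2))/integrableP[_] := expectable_mul hH hH Tt.
apply: le_lt_trans; apply: ge0_le_integral => //.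
- move=> y _; rewrite lee_fin mulr_ge0 ?sqr_ge0// ltW//.
  exact: (density_gt0 regM Tt).
- apply/measurable_EFinP/measurable_funM; last exact: (density_measurable regM Tt).
  by apply: measurable_funX; apply: measurable_funM => //; have [] := hH.
- apply: measurableT_comp => //; apply/measurable_EFinP/measurable_funM.
    apply: measurable_funM => //.
    by apply: measurable_funM; have [] := hH.
  exact: (density_measurable regM Tt).
- by move=> y _ /=; rewrite lee_fin exprMn -expr2 ler_norm.
Qed.

(** Square integrability implies integrability because the densities have mass 1,
which puts the constant 1 in [HM]. *)
Lemma HM_expectable h t : HM mu Theta m h -> Theta t -> expectable t h.
Proof.
move=> hH Tt; have H1 : HM mu Theta m (fun=> 1).
  split=> // u Tu; under eq_integral do rewrite expr1n mul1r.
  by rewrite (density_mass1 regM)// ltry.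
apply: eq_integrable (expectable_mul hH H1 Tt) => // y _ /=.
by rewrite mulr1.
Qed.

Lemma Expect_mulZ h q t a b : HM mu Theta m h -> HM mu Theta m q -> Theta t ->
  Expect mu m t (fun y => (a * h y) * (b * q y)) =
  a * b * Expect mu m t (fun y => h y * q y).
Proof.
move=> hH hq Tt; rewrite -ExpectZ; last exact: expectable_mul.
by congr Expect; apply/funext => y; rewrite mulrACA.
Qed.

Lemma innerZr h q t c : expectable t (fun y => h y * q y) ->
  inner mu m t h (fun y => c * q y) = c * inner mu m t h q.
Proof.
move=> ihq; rewrite /inner -ExpectZ//.
by congr Expect; apply/funext => y; rewrite mulrCA.
Qed.

Lemma inner_residual h q t c : HM mu Theta m h -> HM mu Theta m q -> Theta t ->
  inner mu m t (fun y => h y - c * q y) q =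
  inner mu m t h q - c * inner mu m t q q.
Proof.
move=> hH hq Tt; rewrite /inner -ExpectZ; last exact: expectable_mul.
rewrite -ExpectB; [|exact: expectable_mul|exact/expectableZ/expectable_mul].
by congr Expect; apply/funext => y; rewrite mulrBl mulrA.
Qed.

(** Cauchy-Schwarz: the squared norm of the residual of h after projection on q
is <h, h> - <h, q> ^ 2 / <q, q>, and it is nonnegative. *)
Lemma inner_sqr_le h q t : HM mu Theta m h -> HM mu Theta m q -> Theta t ->
  0 < inner mu m t q q ->
  inner mu m t h q ^+ 2 / inner mu m t q q <= inner mu m t h h.
Proof.
move=> hH hq Tt q0; set c := inner mu m t h q / inner mu m t q q.
have /(Expect_ge0 Tt) : forall y, 0 <= (h y - c * q y) ^+ 2.
  by move=> y; exact: sqr_ge0.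
have -> : (fun y => (h y - c * q y) ^+ 2) =
    (fun y => (h y * h y - (c * 2) * (h y * q y)) - (- (c ^+ 2)) * (q y * q y)).
  by apply/funext => y; ring.
have ihh := expectable_mul hH hH Tt.
have ihq := expectable_mul hH hq Tt.
have iqq := expectable_mul hq hq Tt.
rewrite ExpectB; last 2 first.
- apply: eq_integrable (integrableB measurableT ihh (expectableZ (c * 2) ihq))
    => //.
  by move=> y _ /=; rewrite -EFinB -mulrBl.
- exact: expectableZ.
rewrite ExpectB//; last exact: expectableZ.
rewrite !ExpectZ// -/(inner mu m t h h) -/(inner mu m t h q) -/(inner mu m t q q).
move=> le0; rewrite -subr_ge0; apply: (le_trans le0).
by rewrite le_eqVlt; apply/orP; left; apply/eqP; rewrite /c; field;
  rewrite gt_eqF.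
Qed.

(** [orth_proj] chooses some element of the line with orthogonal residual, so the
formula needs both existence and uniqueness: orthogonality to q alone already
forces the coefficient. *)
Lemma orth_projE h q t : HM mu Theta m h -> HM mu Theta m q -> Theta t ->
  0 < inner mu m t q q ->
  orth_proj mu m t (line q) h =
  fun y => inner mu m t h q / inner mu m t q q * q y.
Proof.
move=> hH hq Tt q0; rewrite /orth_proj; set P := [set p | _].
have [] : P (xget (fun=> 0) P).
  apply: xgetPex; exists (fun y => inner mu m t h q / inner mu m t q q * q y).
  split=> [|_ [b ->]]; first by eexists.
  rewrite innerZr ?inner_residual ?divfK ?gt_eqF ?subrr ?mulr0//.
  set c := _ / _.
  apply: eq_integrable (integrableB measurableT (expectable_mul hH hq Tt)
    (expectableZ c (expectable_mul hq hq Tt))) => // y _ /=.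
  by rewrite -EFinB; congr EFin; ring.
move=> [c pE]; rewrite pE => /(_ q) h0.
have : inner mu m t (fun y => h y - c * q y) q = 0.
  by apply: h0; exists 1; apply/funext => y; rewrite mul1r.
rewrite inner_residual// => /eqP; rewrite subr_eq0 => /eqP ->.
by apply/funext => y; rewrite mulfK ?gt_eqF.
Qed.
End Expectation.

(** * Information of a generalized estimator *)

Section Information.
Context (R : realType) (d : measure_display) (Y : measurableType d).
Context (mu : {measure set Y -> \bar R}) (Theta : set R) (m : R -> Y -> R).
Context (regM : regular_family mu Theta m).
Implicit Types (f g : Y -> R -> R) (t : R).

Lemma VVE f t : VV mu m f t = inner mu m t (f ^~ t) (f ^~ t).
Proof. by congr Expect; apply/funext => y; rewrite expr2. Qed.

(** E g vanishes on the open set Theta, so its derivative E (grad g) + E (s g)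
is 0. *)
Lemma EE_grad g t : gen_estimator mu Theta m g -> Theta t ->
  EE mu m (grad g) t = - inner mu m t (score m ^~ t) (g ^~ t).
Proof.
move=> [gC1 gH g0 VC1] Tt.
have [_ dE] := diff_expect regM gC1 (fun t Tt => (gH t Tt).1) g0 VC1 Tt.
have : is_derive t 1 (EE mu m g) 0.
  apply: (@near_eq_is_derive _ _ _ (cst 0)).
  apply: (@near_open_eq _ Theta) => //; first exact: Theta_open regM.
  by move=> u Tu; rewrite -(gH u Tu).2.
move=> [_ d0]; case: dE => _; rewrite d0 => /esym/eqP.
by rewrite addr_eq0 => /eqP.
Qed.

(** Rescaling by a C1 function of the parameter keeps the mean zero and the
sections C1; regularity of the second moment is trivial, since it becomes 1. *)
Lemma gen_estimator_standardize g :
  gen_estimator mu Theta m g -> gen_estimator mu Theta m (standardize mu m g).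
Proof.
move=> [gC1 gH g0 VC1]; have oT := Theta_open regM.
have stE t : standardize mu m g ^~ t =
    fun y => (Num.sqrt (VV mu m g t))^-1 * g y t.
  by apply/funext => y; rewrite /standardize mulrC.
have V1 t : Theta t -> VV mu m (standardize mu m g) t = 1.
  move=> Tt; have gHt := (gH t Tt).1.
  rewrite VVE stE /inner (Expect_mulZ regM)// -/(inner _ _ _ _ _) -VVE.
  by rewrite -invfM -expr2 sqr_sqrtr ?mulVf// ?gt_eqF ?ltW// g0.
split.
- apply: filterS gC1 => y gyC1; apply: C1_onM => //.
  exact: C1_on_inv_sqrt.
- move=> t Tt; have [gHt gt0] := gH t Tt; rewrite stE; split.
    exact: HMZ.
  by rewrite ExpectZ ?gt0 ?mulr0//; exact: (HM_expectable regM).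
- by move=> t Tt; rewrite V1.
- exact: C1_on_cst V1.
Qed.

(** [EE_grad] for the standardized estimator, whose scaling factor depends only
on the parameter and so leaves the inner product with the score. *)
Lemma LambdaE g t : gen_estimator mu Theta m g -> Theta t ->
  Lambda mu m g t = inner mu m t (score m ^~ t) (g ^~ t) ^+ 2 / VV mu m g t.
Proof.
move=> gG Tt; have [_ sH _ _] := score_estimator regM.
have [_ gH g0 _] := gG.
rewrite /Lambda (EE_grad (gen_estimator_standardize gG) Tt) sqrrN.
have -> : inner mu m t (score m ^~ t) (standardize mu m g ^~ t) =
    (Num.sqrt (VV mu m g t))^-1 * inner mu m t (score m ^~ t) (g ^~ t).
  rewrite -[(Num.sqrt _)^-1]mul1r -(Expect_mulZ regM)//; last 2 first.
  - exact: (sH t Tt).1.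
  - exact: (gH t Tt).1.
  by congr Expect; apply/funext => y; rewrite mul1r /standardize [g y t / _]mulrC.
by rewrite exprMn exprVn sqr_sqrtr ?ltW ?g0// mulrC.
Qed.

Lemma VV_proj_score g t : gen_estimator mu Theta m g -> Theta t ->
  VV mu m (proj_score mu m g) t =
  inner mu m t (score m ^~ t) (g ^~ t) ^+ 2 / VV mu m g t.
Proof.
move=> [_ gH g0 _] Tt; have [_ sH _ _] := score_estimator regM.
have gHt := (gH t Tt).1; have sHt := (sH t Tt).1.
have q0 : 0 < inner mu m t (g ^~ t) (g ^~ t) by rewrite -VVE g0.
rewrite !VVE /proj_score (orth_projE regM)//.
rewrite /inner (Expect_mulZ regM)// -!/(inner _ _ _ _ _).
by field; rewrite gt_eqF.
Qed.

Lemma corrE g t : gen_estimator mu Theta m g -> Theta t ->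
  corr mu m (score m) g t =
  inner mu m t (score m ^~ t) (g ^~ t) /
    (Num.sqrt (fisher_info mu m t) * Num.sqrt (VV mu m g t)).
Proof.
move=> [_ gH _ _] Tt; have [_ sH _ _] := score_estimator regM.
rewrite /inner invfM mulrC -(Expect_mulZ regM); first last.
- exact: Tt.
- exact: (gH t Tt).1.
- exact: (sH t Tt).1.
by congr Expect; apply/funext => y; rewrite /standardize !(mulrC _^-1).
Qed.
End Information.

Theorem theorem1 (R : realType) (d : measure_display) (Y : measurableType d)
    (mu : {measure set Y -> \bar R}) (Theta : set R) (m : R -> Y -> R)
    (regM : regular_family mu Theta m) :
  [/\ forall g : Y -> R -> R, gen_estimator mu Theta m g ->
        forall t, Theta t -> Lambda mu m g t <= fisher_info mu m t,
      forall t, Theta t -> Lambda mu m (score m) t = fisher_info mu m t &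
      forall g : Y -> R -> R, gen_estimator mu Theta m g ->
        forall t, Theta t ->
          [/\ Lambda mu m g t = EE mu m (grad g) t ^+ 2 / VV mu m g t,
              Lambda mu m g t = VV mu m (proj_score mu m g) t &
              VV mu m (proj_score mu m g) t =
                corr mu m (score m) g t ^+ 2 * fisher_info mu m t]].
Proof.
have sG := score_estimator regM; have [_ sH I0 _] := sG.
have IE t : fisher_info mu m t = inner mu m t (score m ^~ t) (score m ^~ t).
  exact: VVE.
split.
- move=> g gG t Tt; have [_ gH g0 _] := gG.
  rewrite (LambdaE regM gG Tt) IE VVE; apply: (inner_sqr_le regM _ _ Tt).
  + exact: (sH t Tt).1.
  + exact: (gH t Tt).1.
  + by rewrite -VVE g0.
- move=> t Tt; rewrite (LambdaE regM sG Tt) -IE -[VV _ _ _ _]/(fisher_info mu m t).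
  by rewrite expr2 mulfK// gt_eqF// I0.
- move=> g gG t Tt; have [_ _ g0 _] := gG.
  rewrite (VV_proj_score regM gG Tt) (LambdaE regM gG Tt).
  rewrite (EE_grad regM gG Tt) sqrrN (corrE regM gG Tt); split=> //.
  rewrite exprMn exprVn exprMn !sqr_sqrtr ?ltW ?g0 ?I0//.
  by field; rewrite !gt_eqF// ?g0 ?I0.
Qed.
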